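(* Let $\mathbb{H}=\{(z_1,z_2)\in \mathbb{C}^2:|z_2|<|z_1|<1\}$ be the Hartogs triangle. Then the Berezin transform $B_{\mathbb{H}}$ is not a bounded mapping on $L^2(\mathbb{H})$; that is, there is no constant $C<\infty$ such that $\|B_{\mathbb{H}}f\|_{L^2(\mathbb{H})}\leq C\|f\|_{L^2(\mathbb{H})}$ for all $f$ in $L^2(\mathbb{H})$ for which $B_{\mathbb{H}}f$ is defined by the integral formula below.
   Context: $K_{\mathbb{H}}$ denotes the Bergman kernel of $\mathbb{H}$ (the reproducing kernel of the Bergman space $A^2(\mathbb{H})$ of square-integrable holomorphic functions on $\mathbb{H}$); explicitly $K_{\mathbb{H}}(w,z)=\frac{w_1\overline{z}_1}{\pi^2(w_1\overline{z}_1-w_2\overline{z}_2)^2(1-w_1\overline{z}_1)^2}$, and $K_{\mathbb{H}}(z,z)>0$ for all $z\in\mathbb{H}$. The Berezin transform of a function $f$ on $\mathbb{H}$ is $B_{\mathbb{H}}f(z)=\int_{\mathbb{H}} f(w)\,\frac{|K_{\mathbb{H}}(w,z)|^2}{K_{\mathbb{H}}(z,z)}\,dV(w)$, $z\in\mathbb{H}$, where $dV$ is Lebesgue measure. *)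

(* Defs.v *)
(* mathcomp-analysis (Lebesgue integration) + real_closed complex numbers. *)
From HB Require Import structures.
From mathcomp Require Import all_boot all_order all_algebra.
From mathcomp Require Import all_classical all_reals all_analysis.
Import Order.TTheory GRing.Theory Num.Theory.
From mathcomp Require Import complex.
Local Notation normc := ComplexField.Normc.normc.

Set Implicit Arguments.
Unset Strict Implicit.
Unset Printing Implicit Defensive.

Local Open Scope ring_scope.
Local Open Scope complex_scope.
Local Open Scope classical_set_scope.

Section Hartogs.
Variable R : realType.

(* Lebesgue measure on R^2 = C, as the product of two copies of Lebesgue
   measure on R (Borel sets); we record that it is sigma-finite, so that the
   library can form the product measure on R^4. *)
Definition leb2 := ((@lebesgue_measure R) \x (@lebesgue_measure R))%E.
HB.instance Definition _ := Measure.on leb2.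

Lemma leb2_sigma_finite : sigma_finite setT leb2.
Proof.
have /sigma_finiteP[F [TF ndF Foo]] := sigma_finiteT (@lebesgue_measure R).
exists (fun n => F n `*` F n).
  rewrite -setXTT TF predeqE => -[x y]; split.
    move=> [/= [n _ Fnx] [k _ Gky]]; exists (maxn n k) => //; split.
    - by move: x Fnx; exact/subsetPset/ndF/leq_maxl.
    - by move: y Gky; exact/subsetPset/ndF/leq_maxr.
  by move=> [n _ []/= ? ?]; split; exists n.
move=> k; have [? ?] := Foo k.
split; first exact: measurableX.
by rewrite /leb2 product_measure1E// lte_mul_pinfty// ge0_fin_numE.
Qed.

HB.instance Definition _ :=
  Measure_isSigmaFinite.Build _ _ _ leb2 leb2_sigma_finite.

(* Lebesgue measure dV on C^2 = R^4 (product of four copies of Lebesgue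
   measure on R). Points are given by real coordinates
   ((Re z1, Im z1), (Re z2, Im z2)). *)
Definition dV := (leb2 \x leb2)%E.
HB.instance Definition _ := Measure.on dV.

Definition R4 := ((measurableTypeR R * measurableTypeR R) *
                  (measurableTypeR R * measurableTypeR R))%type.

(* The point of C^2 with given real coordinates. *)
Definition toC2 (x : R4) : R[i] * R[i] :=
  ((x.1.1 +i* x.1.2), (x.2.1 +i* x.2.2)).

(* The Hartogs triangle H = {(z1,z2) in C^2 : |z2| < |z1| < 1}. *)
Definition hartogs (z : R[i] * R[i]) : Prop :=
  normc z.2 < normc z.1 /\ normc z.1 < 1.

Definition Hset : set R4 := [set x | hartogs (toC2 x)].

(* The Bergman kernel of H, as given explicitly in the paper. *)
Definition KH (w z : R[i] * R[i]) : R[i] :=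
  (w.1 * z.1^*) /
  ((pi%:C) ^+ 2 * (w.1 * z.1^* - w.2 * z.2^*) ^+ 2 * (1 - w.1 * z.1^*) ^+ 2).

(* Complex-valued functions: measurability / integrability / integral are
   taken componentwise (real and imaginary parts). *)
Definition cmeasurable (D : set R4) (f : R4 -> R[i]) : Prop :=
  measurable_fun D (fun x => complex.Re (f x)) /\
  measurable_fun D (fun x => complex.Im (f x)).

Definition cintegrable (D : set R4) (f : R4 -> R[i]) : Prop :=
  dV.-integrable D (fun x => (complex.Re (f x))%:E) /\
  dV.-integrable D (fun x => (complex.Im (f x))%:E).

Definition cintegral (D : set R4) (f : R4 -> R[i]) : R[i] :=
  (Rintegral dV D (fun x => complex.Re (f x)))%:C +
  'i * (Rintegral dV D (fun x => complex.Im (f x)))%:C.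

(* The Berezin kernel |K(w,z)|^2 / K(z,z). *)
Definition berezin_kernel (w z : R[i] * R[i]) : R[i] :=
  ((normc (KH w z)) ^+ 2)%:C / KH z z.

(* The integrand defining B_H f (z). *)
Definition berezin_integrand (f : R4 -> R[i]) (z : R4) : R4 -> R[i] :=
  fun w => f w * berezin_kernel (toC2 w) (toC2 z).

(* B_H f is defined by the integral formula (the integral converges
   absolutely) at every z in H. *)
Definition berezin_defined (f : R4 -> R[i]) : Prop :=
  forall z, Hset z -> cintegrable Hset (berezin_integrand f z).

(* The Berezin transform B_H f (z) = \int_H f(w) |K(w,z)|^2/K(z,z) dV(w). *)
Definition berezin (f : R4 -> R[i]) (z : R4) : R[i] :=
  cintegral Hset (berezin_integrand f z).

(* L^2(H) norm, as an extended real: (\int_H |f|^2 dV)^(1/2). *)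
Definition L2norm (f : R4 -> R[i]) : \bar R :=
  ((\int[dV]_(x in Hset) ((normc (f x)) ^+ 2)%:E) `^ (2^-1))%E.

(* f belongs to L^2(H): measurable on H with finite L^2 norm. *)
Definition inL2 (f : R4 -> R[i]) : Prop :=
  cmeasurable Hset f /\ (\int[dV]_(x in Hset) ((normc (f x)) ^+ 2)%:E < +oo)%E.

End Hartogs.

(* Main.v *)
(** In the coordinates (w_1, u) with w_2 = w_1 u the Berezin kernel of H is
    |w_1|^-2 times that of the bidisc, while dV carries the weight |w_1|^2: near
    the singular point the transform behaves like integration of f |w_1|^-2
    against dV.  A truncation of |w_1|^-2 at scale 2^-n has squared L^2 norm of
    order n, but its transform is at least of order n on a fixed set, so
    n <= C sqrt n would follow for all n.  The truncation is realised by a step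
    function on n disjoint dyadic boxes, the k-th being a copy of a fixed box
    scaled by 2^-k, with value of order 4^k and volume of order 16^-k. *)
Require Import Defs.
From mathcomp Require Import all_boot all_order all_algebra.
From mathcomp Require Import all_classical all_reals all_analysis.
Import Order.TTheory GRing.Theory Num.Theory.
From mathcomp Require Import complex.
From mathcomp Require Import measurable_realfun ring lra.

Local Notation normc := ComplexField.Normc.normc.
Local Open Scope complex_scope.
Local Open Scope classical_set_scope.
Local Open Scope ring_scope.

Set Implicit Arguments.
Unset Strict Implicit.
Unset Printing Implicit Defensive.

(** * The Berezin kernel in real form and its two-sided comparison with |w_1|^-2 *)

Section Kernel.
Variable R : realType.
Implicit Types (z w : R[i] * R[i]).

Lemma sqr_normcE (x : R[i]) : normc x ^+ 2 = complex.Re x ^+ 2 + complex.Im x ^+ 2.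
Proof. by case: x => a b /=; rewrite sqr_sqrtr // addr_ge0 // sqr_ge0. Qed.

Lemma normc_conjc (x : R[i]) : normc x^* = normc x.
Proof. by case: x => a b /=; rewrite sqrrN. Qed.

Lemma normc_ge0 (x : R[i]) : 0 <= normc x.
Proof. by case: x => a b /=; exact: sqrtr_ge0. Qed.

Lemma normc_real (x : R) : normc x%:C = `|x|.
Proof. by rewrite /= expr0n addr0 sqrtr_sqr. Qed.

Lemma mulc_conjE (x : R[i]) : x * x^* = (normc x ^+ 2)%:C.
Proof. by rewrite sqr_normcE; case: x => a b /=; simpc; congr (_ +i* _); ring. Qed.

Lemma normcB_ge (x y : R[i]) : normc x - normc y <= normc (x - y).
Proof. by rewrite lerBlDr -[in leLHS](subrK y x); exact: le_normcD. Qed.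

Lemma normcB_le (x y : R[i]) : normc (x - y) <= normc x + normc y.
Proof. by rewrite -(normcN y); exact: le_normcD. Qed.

Lemma normcX (x : R[i]) n : normc (x ^+ n) = normc x ^+ n.
Proof.
elim: n => [|n IHn]; first by rewrite !expr0 ComplexField.Normc.normc1.
by rewrite !exprS ComplexField.Normc.normcM IHn.
Qed.

(** Closed form of |K(w,z)|^2 / K(z,z) as a real number, after cancelling |z_1|^2 and pi^2. *)
Definition berR w z : R :=
  normc w.1 ^+ 2 * (normc z.1 ^+ 2 - normc z.2 ^+ 2) ^+ 2 *
    (1 - normc z.1 ^+ 2) ^+ 2 /
  (pi ^+ 2 * normc (w.1 * z.1^* - w.2 * z.2^*) ^+ 4 *
    normc (1 - w.1 * z.1^*) ^+ 4).

Lemma berezin_kernelE w z : z.1 != 0 -> berezin_kernel w z = (berR w z)%:C.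
Proof.
move=> z0.
have N0 : normc z.1 != 0 by apply: contra z0 => /eqP/ComplexField.Normc.eq0_normc->.
have p0 : (pi : R) != 0 by rewrite gt_eqF // pi_gt0.
rewrite /berezin_kernel /KH !mulc_conjE.
(* K(z,z) is real, so the embedding of the reals can be pulled out of the quotient. *)
have -> (A B D P : R) : A%:C / (P%:C ^+ 2 * (A%:C - B%:C) ^+ 2 * (1 - D%:C) ^+ 2)
   = (A / (P ^+ 2 * (A - B) ^+ 2 * (1 - D) ^+ 2))%:C.
  by rewrite !(rmorphM, rmorphXn, rmorphB, fmorphV, rmorph1).
rewrite -fmorphV -rmorphM /berR; congr (_%:C).
rewrite !(normcX, ComplexField.Normc.normcM, ComplexField.Normc.normcV).
rewrite normc_real normc_conjc ger0_norm ?pi_ge0 //.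
move: N0 p0; set A := normc w.1; set B := normc z.1.
set D := normc (_ - _); set D' := normc (1 - _).
move=> N0 p0; rewrite !(invfM, invrK, exprMn, exprVn, =^~exprM) /=.
(* [D] and [D'] may vanish, since [w] is arbitrary; with their inverses as free variables, [field]
   only asks that |z_1| and pi be nonzero. *)
move: D^-1 D'^-1 (pi : R) p0 => d d' p p0; field.
by rewrite p0 N0.
Qed.

(** By the reverse triangle inequality |w_1 z_1^* - w_2 z_2^*| >= |w_1| (|z_1| - |z_2|) and |1 - w_1
    z_1^*| >= 1 - |z_1|. The constant depends on [z] alone, which is what integrability in [w]
    requires. *)
Lemma berR_le z : hartogs z -> exists2 M : R, 0 <= M &
  forall w, hartogs w -> berR w z <= M / normc w.1 ^+ 2.
Proof.
case; move=> h21 h1.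
exists ((pi ^+ 2 * (normc z.1 - normc z.2) ^+ 4 * (1 - normc z.1) ^+ 4)^-1).
  by rewrite invr_ge0 !mulr_ge0 ?exprn_ge0 ?pi_ge0 ?subr_ge0 // ltW.
move=> w [k21 k1].
have := normcB_ge 1 (w.1 * z.1^*).
have := normcB_ge (w.1 * z.1^*) (w.2 * z.2^*).
rewrite /berR !ComplexField.Normc.normcM !normc_conjc ComplexField.Normc.normc1.
have := normc_ge0 z.2; have := normc_ge0 w.2.
move: (normc (_ - _)) (normc (1 - _)) (normc w.1) (normc w.2) (normc z.1)
  (normc z.2) h21 h1 k21 k1.
(* A real inequality remains: [A], [A2], [B], [B2] are the moduli of w_1, w_2, z_1, z_2, and [D],
   [D'] those of the two differences. *)
change (forall D D' A A2 B B2 : R, B2 < B -> B < 1 -> A2 < A -> A < 1 -> 0 <= A2 ->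
  0 <= B2 -> A * B - A2 * B2 <= D -> 1 - A * B <= D' ->
  A ^+ 2 * (B ^+ 2 - B2 ^+ 2) ^+ 2 * (1 - B ^+ 2) ^+ 2 / (pi ^+ 2 * D ^+ 4 * D' ^+ 4)
  <= (pi ^+ 2 * (B - B2) ^+ 4 * (1 - B) ^+ 4)^-1 / A ^+ 2).
move=> D D' A A2 B B2 h21 h1 k21 k1 A20 B20 D1 D2.
have {}D1 : A * (B - B2) <= D.
  by apply: le_trans D1; rewrite mulrBr lerD2l lerN2 ler_wpM2r // ltW.
have {}D2 : 1 - B <= D' by apply: le_trans D2; nra.
have X4 (x : R) : 0 <= x ^+ 4 by exact: exprn_even_ge0.
have A0 : 0 < A by lra.
have p0 : 0 < (pi : R) := pi_gt0 R.
have q0 : 0 < A * (B - B2) by rewrite mulr_gt0 // subr_gt0.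
have q1 : 0 < 1 - B by rewrite subr_gt0.
have D0 : 0 < D := lt_le_trans q0 D1.
have D'0 : 0 < D' := lt_le_trans q1 D2.
have e1 : (A * (B - B2)) ^+ 4 <= D ^+ 4.
  by rewrite lerXn2r // nnegrE ltW // (lt_le_trans q0).
have e2 : (1 - B) ^+ 4 <= D' ^+ 4.
  by rewrite lerXn2r // nnegrE ltW // (lt_le_trans q1).
apply: (@le_trans _ _ (A ^+ 2 / (pi ^+ 2 * (A * (B - B2)) ^+ 4 * (1 - B) ^+ 4))).
  apply: ler_pM.
  - exact: mulr_ge0 (mulr_ge0 (sqr_ge0 _) (sqr_ge0 _)) (sqr_ge0 _).
  - by rewrite invr_ge0; exact: mulr_ge0 (mulr_ge0 (sqr_ge0 _) (X4 _)) (X4 _).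
  - have a0 : 0 <= B ^+ 2 - B2 ^+ 2 by nra.
    have a1 : B ^+ 2 - B2 ^+ 2 <= 1 by nra.
    have b0 : 0 <= 1 - B ^+ 2 by nra.
    have b1 : 1 - B ^+ 2 <= 1 by nra.
    rewrite -mulrA; apply: ler_piMr; first exact: sqr_ge0.
    by rewrite mulr_ile1 ?sqr_ge0 // exprn_ile1.
  - rewrite lef_pV2 ?posrE ?mulr_gt0 ?exprn_gt0 ?subr_gt0 //.
    by apply: ler_pM => //; [exact: mulr_ge0 (sqr_ge0 _) (X4 _)|rewrite ler_wpM2l ?sqr_ge0].
rewrite le_eqVlt; apply/orP; left; apply/eqP.
move: (pi : R) p0 => p p0; field.
by rewrite !gt_eqF ?subr_gt0.
Qed.

(** The two differences in the denominator have moduli at most 2|w_1| and 2, so their fourth powers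
    multiply to at most 2^8 |w_1|^4. *)
Lemma berR_ge z w : hartogs z -> hartogs w ->
  (normc z.1 ^+ 2 - normc z.2 ^+ 2) ^+ 2 * (1 - normc z.1 ^+ 2) ^+ 2 /
    (2 ^+ 8 * pi ^+ 2) / normc w.1 ^+ 2 <= berR w z.
Proof.
move=> [h21 h1] [k21 k1].
have := normcB_ge 1 (w.1 * z.1^*).
have := normcB_ge (w.1 * z.1^*) (w.2 * z.2^*).
have := normcB_le 1 (w.1 * z.1^*).
have := normcB_le (w.1 * z.1^*) (w.2 * z.2^*).
rewrite /berR !ComplexField.Normc.normcM !normc_conjc ComplexField.Normc.normc1.
have := normc_ge0 z.2; have := normc_ge0 w.2.
move: (normc (_ - _)) (normc (1 - _)) (normc w.1) (normc w.2) (normc z.1)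
  (normc z.2) h21 h1 k21 k1.
change (forall D D' A A2 B B2 : R, B2 < B -> B < 1 -> A2 < A -> A < 1 -> 0 <= A2 ->
  0 <= B2 -> D <= A * B + A2 * B2 -> D' <= 1 + A * B ->
  A * B - A2 * B2 <= D -> 1 - A * B <= D' ->
  (B ^+ 2 - B2 ^+ 2) ^+ 2 * (1 - B ^+ 2) ^+ 2 / (2 ^+ 8 * pi ^+ 2) / A ^+ 2 <=
  A ^+ 2 * (B ^+ 2 - B2 ^+ 2) ^+ 2 * (1 - B ^+ 2) ^+ 2 / (pi ^+ 2 * D ^+ 4 * D' ^+ 4)).
move=> D D' A A2 B B2 h21 h1 k21 k1 A20 B20 D1 D2 D1' D2'.
have X4 (x : R) : 0 <= x ^+ 4 by exact: exprn_even_ge0.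
have A0 : 0 < A by lra.
have p0 : 0 < (pi : R) := pi_gt0 R.
have D0 : 0 < D.
  by apply: lt_le_trans D1'; rewrite subr_gt0 ltr_pM.
have D'0 : 0 < D'.
  apply: lt_le_trans D2'; nra.
have {}D1 : D <= 2 * A.
  apply: le_trans D1 _; nra.
have {}D2 : D' <= 2 by apply: le_trans D2 _; nra.
have e1 : D ^+ 4 <= (2 * A) ^+ 4.
  by rewrite lerXn2r // nnegrE ltW // mulr_gt0.
have e2 : D' ^+ 4 <= 2 ^+ 4 by rewrite lerXn2r // nnegrE ltW.
rewrite -[A ^+ 2 * _ * _]mulrA.
set u := _ ^+ 2 * (1 - _) ^+ 2.
have u0 : 0 <= u by rewrite mulr_ge0 ?sqr_ge0.
apply: (@le_trans _ _ (A ^+ 2 * u / (pi ^+ 2 * (2 * A) ^+ 4 * 2 ^+ 4))).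
  rewrite le_eqVlt; apply/orP; left; apply/eqP.
  move: (pi : R) p0 => p p0; field.
  by rewrite !gt_eqF.
apply: ler_wpM2l; first exact: mulr_ge0 (sqr_ge0 _) u0.
rewrite lef_pV2 ?posrE; do ?[exact: mulr_gt0 | apply: mulr_gt0 | apply: exprn_gt0] => //.
by apply: ler_pM => //; [exact: mulr_ge0 (sqr_ge0 _) (X4 _)|rewrite ler_wpM2l ?sqr_ge0].
Qed.

(** Squared moduli are polynomials in the real coordinates, so no square root remains. *)
Lemma hartogsE z : hartogs z <->
  normc z.2 ^+ 2 < normc z.1 ^+ 2 /\ normc z.1 ^+ 2 < 1.
Proof.
by rewrite /hartogs expr_lt1 ?ltr_pXn2r ?nnegrE ?normc_ge0.
Qed.
End Kernel.

(** * Disjoint dyadic boxes inside the Hartogs triangle *)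

Section Boxes.
Variable R : realType.

(** The shift by 2 gives [side k <= 1/4], hence |w_1|^2 <= 5/16 < 1 on every box. *)
Definition side (k : nat) : R := 2^-1 ^+ k.+2.

(** Re w_1 alone separates the boxes, its intervals being half-open; the halved sides for w_2 keep
    |w_2| below |w_1|. *)
Definition box (k : nat) : set (R4 R) :=
  (`]side k, 2 * side k] `*` `[0, side k]) `*` (`[0, side k / 2] `*` `[0, side k / 2]).

Lemma side_gt0 k : 0 < side k.
Proof. by rewrite exprn_gt0. Qed.

Lemma measurable_box k : measurable (box k).
Proof. by apply: measurableX; apply: measurableX; exact: measurable_itv. Qed.

Lemma dV_box k : dV (box k) = (side k ^+ 4 / 4)%:E.
Proof.
have h0 := side_gt0 k.
rewrite /box /dV product_measure1E; first last.
- by apply: measurableX; exact: measurable_itv.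
- by apply: measurableX; exact: measurable_itv.
have E1 (A B : set (measurableTypeR R)) : measurable A -> measurable B ->
    leb2 (A `*` B) = (lebesgue_measure A * lebesgue_measure B)%E.
  by move=> mA mB; exact: product_measure1E.
rewrite [X in X = _](_ : _ = mule (leb2 (`]side k, 2 * side k] `*` `[0, side k]))
   (leb2 (`[0, side k / 2] `*` `[0, side k / 2]))); last by [].
rewrite !E1; try exact: measurable_itv.
rewrite !lebesgue_measure_itv /= !lte_fin h0 divr_gt0 // ltr_pMl // ltr1n.
rewrite -!EFinB -!EFinM; congr EFin; by field.
Qed.

(** The constants are 5 = 2^2 + 1^2 for w_1 and 1/2 = 1/4 + 1/4 for w_2. *)
Lemma box_bounds k (x : R4 R) : box k x ->
  side k < x.1.1 <= 2 * side k /\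
  (side k) ^+ 2 <= normc (toC2 x).1 ^+ 2 <= 5 * side k ^+ 2 /\
  normc (toC2 x).2 ^+ 2 <= side k ^+ 2 / 2.
Proof.
have := side_gt0 k; rewrite !sqr_normcE /box /= !in_itv /=.
by move: (side k) => h h0 [[/andP[? ?] /andP[? ?]] [/andP[? ?] /andP[? ?]]]; split; nra.
Qed.

Lemma side_le k : side k <= 4^-1.
Proof.
have -> : side k = 4^-1 * 2^-1 ^+ k by rewrite /side !exprS; field.
by apply: ler_piMr; rewrite ?exprn_ile1 ?invf_le1 ?ler1n.
Qed.

Lemma box_Hset k : box k `<=` @Hset R.
Proof.
move=> x /box_bounds [_ [/andP[]]]; rewrite /Hset /mkset hartogsE.
have := side_gt0 k; have := side_le k.
by move: (side k) => h h0 h1 h2 h3 h4; split; nra.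
Qed.

(** For j < k the interval of Re w_1 in [box k] ends at [2 * side k <= side j], where the one in
    [box j] begins, excluding that endpoint. *)
Lemma box_inj j k x : box j x -> box k x -> j = k.
Proof.
wlog jk : j k / (j < k)%N => [H|].
  by case: (ltngtP j k) => // jk bj bk; [exact: H|apply/esym/H].
move=> /box_bounds [/andP[+ _] _] /box_bounds [/andP[_ +] _] => h1 h2.
have : 2 * side k <= side j.
  rewrite /side [_ ^+ k.+2]exprS mulrA divff ?mul1r //.
  by apply: ler_wiXn2l => //; rewrite invf_le1 // ler1n.
by move=> h3; move: (lt_le_trans h1 (le_trans h2 h3)); rewrite ltxx.
Qed.

(** * Measurability of the domain and of the kernel *)

Let m11 : measurable_fun setT (fun x : R4 R => x.1.1 : R).
Proof. by apply: measurableT_comp; exact: measurable_fst. Qed.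
Let m12 : measurable_fun setT (fun x : R4 R => x.1.2 : R).
Proof. by apply: measurableT_comp; [exact: measurable_snd|exact: measurable_fst]. Qed.
Let m21 : measurable_fun setT (fun x : R4 R => x.2.1 : R).
Proof. by apply: measurableT_comp; [exact: measurable_fst|exact: measurable_snd]. Qed.
Let m22 : measurable_fun setT (fun x : R4 R => x.2.2 : R).
Proof. by apply: measurableT_comp; exact: measurable_snd. Qed.

Lemma measurable_Hset : measurable (@Hset R).
Proof.
have mN (f g : R4 R -> R) : measurable_fun setT f -> measurable_fun setT g ->
    measurable_fun setT (fun x => f x ^+ 2 + g x ^+ 2).
  by move=> mf mg; apply: measurable_funD; exact: measurable_funX.
have mlt (f g : R4 R -> R) : measurable_fun setT f -> measurable_fun setT g ->
    measurable [set x | f x < g x].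
  move=> mf mg; have /(_ measurableT [set true]) := measurable_fun_ltr mf mg.
  by rewrite setTI; apply.
have -> : @Hset R = [set x | x.2.1 ^+ 2 + x.2.2 ^+ 2 < x.1.1 ^+ 2 + x.1.2 ^+ 2] `&`
   [set x | x.1.1 ^+ 2 + x.1.2 ^+ 2 < 1].
  by apply/seteqP; split=> x; rewrite /Hset /mkset hartogsE !sqr_normcE.
by apply: measurableI; apply: mlt => //; exact: mN.
Qed.

Lemma measurable_invr_ge0 d (T : measurableType d) (f : T -> R) :
  (forall x, 0 <= f x) -> measurable_fun setT f ->
  measurable_fun setT (fun x => (f x)^-1).
Proof.
(* On nonnegative reals inversion is the power -1, also at 0, where both give 0. *)
move=> f0 mf; rewrite (_ : (fun _ => _) = (@powR R ^~ (-1)) \o f).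
  by apply: measurableT_comp => //; exact: measurable_powR.
by apply/funext => x /=; rewrite powR_inv1.
Qed.

(** In [w] only even powers of moduli occur, which are polynomials in the coordinates; the one
    inverse is of a nonnegative function. *)
Lemma measurable_berR z : measurable_fun setT (fun x : R4 R => berR (toC2 x) z).
Proof.
have mN (c : R4 R -> R[i]) : cmeasurable setT c ->
    measurable_fun setT (fun x => normc (c x) ^+ 2).
  move=> [mr mi]; under eq_fun do rewrite sqr_normcE.
  by apply: measurable_funD; exact: measurable_funX.
have mN4 (c : R4 R -> R[i]) : cmeasurable setT c ->
    measurable_fun setT (fun x => normc (c x) ^+ 4).
  move=> /mN mc; rewrite (_ : (fun _ => _) = (fun x => (normc (c x) ^+ 2) ^+ 2)).
    exact: measurable_funX.
  by apply/funext => x; rewrite -exprM.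
have mB (c e : R4 R -> R[i]) : cmeasurable setT c -> cmeasurable setT e ->
    cmeasurable setT (fun x => c x - e x).
  move=> [c1 c2] [e1 e2]; split.
    by under eq_fun do rewrite raddfB; exact: measurable_funB.
  by under eq_fun do rewrite raddfB; exact: measurable_funB.
have mM (c : R4 R -> R[i]) (a : R[i]) : cmeasurable setT c ->
    cmeasurable setT (fun x => c x * a).
  case: a => a b [c1 c2]; split.
    rewrite (_ : (fun _ => _) = (fun x => complex.Re (c x) * a - complex.Im (c x) * b)).
      by apply: measurable_funB; apply: measurable_funM.
    by apply/funext => x; case: (c x).
  rewrite (_ : (fun _ => _) = (fun x => complex.Re (c x) * b + complex.Im (c x) * a)).
    by apply: measurable_funD; apply: measurable_funM.
  by apply/funext => x; case: (c x).
have mC (a : R[i]) : cmeasurable setT (fun _ : R4 R => a) by split; exact: measurable_cst.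
have m1 : cmeasurable setT (fun x : R4 R => (toC2 x).1) by split.
have m2 : cmeasurable setT (fun x : R4 R => (toC2 x).2) by split.
rewrite /berR; apply: measurable_funM.
  apply: measurable_funM; last exact: measurable_cst.
  by apply: measurable_funM; [exact: mN|exact: measurable_cst].
apply: measurable_invr_ge0.
  move=> x; have ge4 (c : R[i]) : 0 <= normc c ^+ 4 by exact/exprn_ge0/normc_ge0.
  exact: mulr_ge0 (mulr_ge0 (sqr_ge0 _) (ge4 _)) (ge4 _).
apply: measurable_funM.
  apply: measurable_funM; first exact: measurable_cst.
  by apply: mN4; apply: (mB) => //; exact: mM.
by apply: mN4; apply: (mB) => //; exact: mM.
Qed.

(** * Step functions on the boxes and their integrals *)

Definition box_sum (a : nat -> R) (n : nat) (x : R4 R) : R :=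
  \sum_(k < n) a k * \1_(box k) x.

Lemma measurable_box_sum a n : measurable_fun setT (box_sum a n).
Proof.
apply: measurable_sum => k; apply: measurable_funM => //.
exact: measurable_indic (measurable_box k).
Qed.

Lemma box_sum_ge0 a n x : (forall k, 0 <= a k) -> 0 <= box_sum a n x.
Proof. by move=> a0; apply: sumr_ge0 => k _; rewrite mulr_ge0. Qed.

(** Turns a kernel bound valid on each box into a bound between step functions. *)
Lemma ler_box_sum a b n x : (forall k, box k x -> a k <= b k) ->
  box_sum a n x <= box_sum b n x.
Proof.
move=> ab; apply: ler_sum => k _.
rewrite indicE; have [/set_mem xk|_] := boolP (x \in box k).
  by rewrite !mulr1 ab.
by rewrite !mulr0.
Qed.

Lemma box_sumM a n c x : c * box_sum a n x = box_sum (fun k => c * a k) n x.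
Proof. by rewrite /box_sum mulr_sumr; apply: eq_bigr => k _; rewrite mulrA. Qed.

(** The boxes are disjoint, so all cross terms vanish. *)
Lemma sqr_box_sum a n x : box_sum a n x ^+ 2 = box_sum (fun k => a k ^+ 2) n x.
Proof.
elim: n => [|n IHn]; first by rewrite /box_sum !big_ord0 expr0n.
rewrite /box_sum !big_ord_recr /= -!/(box_sum _ _ _) sqrrD IHn.
rewrite indicE; have [/set_mem xn|_] := boolP (x \in box n); last first.
  by rewrite !mulr0 mul0rn expr0n /= !addr0.
suff -> : box_sum a n x = 0 by rewrite !mulr1 mul0r mul0rn addr0.
apply: big1 => k _; rewrite indicE; have [/set_mem xk|_] := boolP (x \in box k).
  by have := ltn_ord k; rewrite (box_inj xk xn) ltnn.
by rewrite mulr0.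
Qed.

Lemma integral_box_sum a n : (forall k, 0 <= a k) ->
  (\int[@dV R]_(x in @Hset R) (box_sum a n x)%:E =
  (\sum_(k < n) a k * (side k ^+ 4 / 4))%:E)%E.
Proof.
move=> a0; have mH := measurable_Hset.
transitivity (\sum_(k < n) \int[@dV R]_(x in @Hset R) (a k * \1_(box k) x)%:E)%E.
  under eq_integral do rewrite /box_sum -sumEFin.
  rewrite ge0_integral_sum //.
  - move=> k; apply/measurable_EFinP; apply: measurable_funM => //.
    exact: measurable_indic (measurable_box k).
  - by move=> k x _; rewrite lee_fin mulr_ge0.
rewrite -sumEFin; apply: eq_bigr => k _.
under eq_integral do rewrite EFinM.
rewrite ge0_integralZl_EFin //; first last.
- by apply/measurable_EFinP; exact: measurable_indic (measurable_box k).
- rewrite integral_indic // ?setIidl //; [|exact: box_Hset|exact: measurable_box].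
  by rewrite [X in (_ * X)%E](dV_box k).
Qed.

Lemma integrable_box_sum a n : (forall k, 0 <= a k) ->
  (@dV R).-integrable (@Hset R) (EFin \o box_sum a n).
Proof.
move=> a0; apply/integrableP; split.
  apply/measurable_EFinP; apply: measurable_funTS; exact: measurable_box_sum.
under eq_integral do rewrite /= ger0_norm ?box_sum_ge0 //.
by rewrite integral_box_sum // ltry.
Qed.

(* [f] need not be measurable, so measurability of the Berezin transform itself
   is never required. *)
Lemma le_integral_cst d (T : measurableType d) (mu : {measure set T -> \bar R})
    (D G : set T) (v : R) (f : T -> \bar R) :
  measurable G -> G `<=` D -> 0 <= v -> (forall x, D x -> 0 <= f x)%E ->
  (forall x, G x -> v%:E <= f x)%E -> (v%:E * mu G <= \int[mu]_(x in D) f x)%E.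
Proof.
move=> mG GD v0 f0 vf; rewrite ge0_integralE //.
(* The integral is a supremum over simple functions below the integrand, and [v] times the indicator
   of [G] is one of them. *)
apply: ereal_sup_ubound; exists (scale_nnsfun (indic_nnsfun R mG) v0).
  move=> x /=; rewrite /patch.
  case: ifPn => [/set_mem Dx|Dx].
    rewrite mindicE; have [/set_mem Gx|_] := boolP (x \in G).
      by rewrite mulr1 vf.
    by rewrite mulr0 f0.
  rewrite mindicE [x \in G]negbTE ?mulr0 //; apply: contra Dx => /set_mem Gx.
  exact/mem_set/GD.
rewrite -integralT_nnsfun /=.
rewrite (eq_integral (fun x => v%:E * (\1_G x)%:E)%E); last by [].
rewrite ge0_integralZl_EFin //; last first.
  by apply/measurable_EFinP; exact: measurable_indic.
by rewrite integral_indic // setIT.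
Qed.

(* On [box k], [wt k] is comparable to [|w_1|^-2]. *)
Definition wt (k : nat) : R := (side k ^+ 2)^-1.

Lemma wt_ge0 k : 0 <= wt k.
Proof. by rewrite invr_ge0 sqr_ge0. Qed.

(** Weight squared times volume is 1/4 on each box, whatever its scale, so the sum grows linearly in
    [n]. *)
Lemma integral_sqr_wt n :
  (\int[@dV R]_(x in @Hset R) (box_sum (fun k => wt k ^+ 2) n x)%:E = (n%:R / 4)%:E)%E.
Proof.
rewrite integral_box_sum => [|k]; last exact: sqr_ge0.
congr EFin; rewrite (eq_bigr (fun=> 4^-1)) => [|k _].
  by rewrite sumr_const card_ord mulr_natl.
by rewrite /wt; have := side_gt0 k; move: (side k) => h h0; field; rewrite gt_eqF.
Qed.

(* For [z] in [box 0], [|z_1|^2 - |z_2|^2 >= 1/32] and [1 - |z_1|^2 >= 1/2], while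
   [|w_1|^2 <= 5 (side k)^2] for [w] in [box k]. *)
Definition kappa : R := 5 ^-1 * (32^-1 ^+ 2 * 2^-1 ^+ 2 / (2 ^+ 8 * pi ^+ 2)).

Lemma kappa_gt0 : 0 < kappa.
Proof.
have p0 : 0 < (pi : R) := pi_gt0 R.
by do ?[apply: mulr_gt0 | rewrite invr_gt0 | apply: exprn_gt0 | done].
Qed.

(** * The kernel compared with the weights on the boxes *)

Lemma toC2_neq0 (z : R4 R) : Hset z -> (toC2 z).1 != 0.
Proof.
move=> [z12 _]; apply/eqP => z0; move: z12; rewrite z0.
by rewrite ComplexField.Normc.normc0 ltNge normc_ge0.
Qed.

Lemma berR_box_ge k (z w : R4 R) : box 0 z -> box k w ->
  kappa * wt k <= berR (toC2 w) (toC2 z).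
Proof.
move=> bz bw; apply: le_trans (berR_ge (box_Hset bz) (box_Hset bw)).
have [_ [/andP[w1 w2] _]] := box_bounds bw.
have [_ [/andP[z1 z2] z3]] := box_bounds bz.
have h0 := side_gt0 k; have h04 : side 0 = 4^-1 by rewrite /side; field.
(* With [side 0 = 1/4] the bounds read 1/16 <= |z_1|^2 <= 5/16 and |z_2|^2 <= 1/32. *)
rewrite h04 in z1 z2 z3; rewrite /wt.
have p0 : 0 < (pi : R) := pi_gt0 R.
have E (X y : R) : 5^-1 * X * y^-1 = X * (5 * y)^-1 by rewrite invfM mulrCA mulrA.
rewrite /kappa E.
have P0 : 0 <= (2 ^+ 8 * pi ^+ 2 : R)^-1.
  by rewrite invr_ge0; apply: mulr_ge0; [exact: exprn_ge0|exact: sqr_ge0].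
apply: ler_pM.
- exact: mulr_ge0 (mulr_ge0 (sqr_ge0 _) (sqr_ge0 _)) P0.
- by rewrite invr_ge0 mulr_ge0 // sqr_ge0.
- apply: ler_wpM2r => //; apply: ler_pM; rewrite ?sqr_ge0 //.
    by rewrite lerXn2r // ?nnegrE; lra.
  by rewrite lerXn2r // ?nnegrE; lra.
- have h1 : 0 < 5 * side k ^+ 2 by rewrite pmulr_rgt0 ?exprn_gt0.
  have h2 : 0 < normc (toC2 w).1 ^+ 2 by apply: lt_le_trans w1; rewrite exprn_gt0.
  by rewrite lef_pV2 ?posrE.
Qed.

Lemma berR_box_le (z : R4 R) : Hset z -> exists2 M, 0 <= M &
  forall k (w : R4 R), box k w -> berR (toC2 w) (toC2 z) <= M * wt k.
Proof.
move=> /berR_le [M M0 HM]; exists M => // k w bw.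
apply: le_trans (HM _ (box_Hset bw)) _.
have [_ [/andP[w1 w2] _]] := box_bounds bw.
have h0 : 0 < side k ^+ 2 by rewrite exprn_gt0 // side_gt0.
by apply: ler_wpM2l => //; rewrite lef_pV2 // posrE // (lt_le_trans h0).
Qed.

Lemma berR_ge0 w z : 0 <= berR w z :> R.
Proof.
have ge4 (c : R[i]) : 0 <= normc c ^+ 4 by exact/exprn_ge0/normc_ge0.
apply: mulr_ge0; first exact: mulr_ge0 (mulr_ge0 (sqr_ge0 _) (sqr_ge0 _)) (sqr_ge0 _).
by rewrite invr_ge0; exact: mulr_ge0 (mulr_ge0 (sqr_ge0 _) (ge4 _)) (ge4 _).
Qed.

(** * The test function, its norm and its transform *)

Section Test_function.
Variable n : nat.
Let f (x : R4 R) : R[i] := (box_sum wt n x)%:C.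
Let fB (z w : R4 R) : R := box_sum wt n w * berR (toC2 w) (toC2 z).

Lemma integrandE z : Hset z -> berezin_integrand f z = fun w => (fB z w)%:C.
Proof.
move=> Hz; apply/funext => w; rewrite /berezin_integrand berezin_kernelE.
  by rewrite -rmorphM.
exact: toC2_neq0.
Qed.

Lemma integrable_integrand z : Hset z -> (@dV R).-integrable (@Hset R) (EFin \o fB z).
Proof.
move=> Hz; have [M M0 HM] := berR_box_le Hz.
have Mc k : 0 <= M * wt k ^+ 2 by rewrite mulr_ge0 // sqr_ge0.
(* On [box k] the integrand is at most [M * wt k ^+ 2]; the step function with these values
   dominates it. *)
apply: le_integrable (integrable_box_sum n Mc); first exact: measurable_Hset.
  apply/measurable_EFinP; apply: measurable_funTS; apply: measurable_funM.
    exact: measurable_box_sum.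
  exact: measurable_berR.
move=> w Hw /=; rewrite lee_fin !ger0_norm ?box_sum_ge0 //; last first.
  by rewrite mulr_ge0 ?berR_ge0 // box_sum_ge0 //; exact: wt_ge0.
rewrite /fB mulrC box_sumM; apply: ler_box_sum => k bw.
by rewrite expr2 mulrA ler_wpM2r ?wt_ge0 // HM.
Qed.

Lemma inL2_test : inL2 f.
Proof.
split.
  split; first by apply: measurable_funTS; exact: measurable_box_sum.
  exact: measurable_cst.
under eq_integral do rewrite normc_real real_normK ?num_real // sqr_box_sum.
by rewrite integral_sqr_wt ltry.
Qed.

Lemma berezin_defined_test : berezin_defined f.
Proof.
move=> z Hz; rewrite /cintegrable (integrandE Hz) /=; split.
  exact: integrable_integrand.
exact: integrable0.
Qed.

Lemma berezin_testE z : Hset z ->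
  berezin f z = (Rintegral (@dV R) (@Hset R) (fB z))%:C.
Proof.
move=> Hz; rewrite /berezin /cintegral (integrandE Hz) /= /Rintegral integral0 /=.
by rewrite mulr0 addr0.
Qed.

(** On [box k] the integrand is at least [kappa * wt k ^+ 2], so the transform is at least [kappa]
    times the squared norm n/4 of the test function. *)
Lemma berezin_test_ge z : box 0 z -> (kappa * (n%:R / 4)) ^+ 2 <= normc (berezin f z) ^+ 2.
Proof.
move=> bz; have Hz := box_Hset bz.
rewrite berezin_testE // normc_real real_normK ?num_real //.
have k0 := kappa_gt0.
suff H : kappa * (n%:R / 4) <= Rintegral (@dV R) (@Hset R) (fB z).
  have H0 : 0 <= kappa * (n%:R / 4) by rewrite mulr_ge0 ?divr_ge0 // ltW.
  by rewrite lerXn2r // ?nnegrE // (le_trans H0).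
have kc k : 0 <= kappa * wt k ^+ 2 by rewrite mulr_ge0 ?sqr_ge0 // ltW.
(* The left side becomes [kappa] times an integral, so that integrands can be compared. *)
rewrite -[leLHS]/(fine (kappa%:E * (n%:R / 4)%:E)%E) -integral_sqr_wt.
rewrite -ge0_integralZl_EFin //; first last.
- exact: ltW.
- by apply/measurable_EFinP; apply: measurable_funTS; exact: measurable_box_sum.
- by move=> w _; rewrite lee_fin box_sum_ge0 // => k; exact: sqr_ge0.
- exact: measurable_Hset.
under eq_integral do rewrite -EFinM box_sumM.
apply: le_Rintegral.
- exact: measurable_Hset.
- exact: integrable_box_sum.
- exact: integrable_integrand.
move=> w Hw; rewrite /fB mulrC box_sumM; apply: ler_box_sum => k bw.
by rewrite expr2 mulrA ler_wpM2r ?wt_ge0 // berR_box_ge.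
Qed.

Lemma L2norm_test : L2norm f = (Num.sqrt (n%:R / 4))%:E.
Proof.
rewrite /L2norm; under eq_integral do rewrite normc_real real_normK ?num_real // sqr_box_sum.
by rewrite integral_sqr_wt poweR_EFin powR12_sqrt // divr_ge0.
Qed.

(** The norm is bounded below by the contribution of [box 0] alone, whose volume (1/4)^4 / 4 =
    (1/32)^2 yields the factor 1/32. *)
Lemma L2norm_berezin_test : ((kappa * (n%:R / 4) / 32)%:E <= L2norm (berezin f))%E.
Proof.
have k0 := ltW kappa_gt0.
have -> : kappa * (n%:R / 4) / 32 =
    ((kappa * (n%:R / 4)) ^+ 2 * (side 0 ^+ 4 / 4)) `^ 2^-1.
  rewrite (_ : _ ^+ 2 * _ = (kappa * (n%:R / 4) / 32) ^+ 2).
    rewrite powR12_sqrt ?sqr_ge0 // sqrtr_sqr ger0_norm //.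
    by rewrite divr_ge0 // mulr_ge0 // divr_ge0.
  by rewrite /side; field.
have pos (y : \bar R) : (0 <= y)%E -> y \in `[0%E, +oo%E].
  by move=> y0; rewrite in_itv /= y0 leey.
have v0 : (0 <= ((kappa * (n%:R / 4)) ^+ 2)%:E)%E by rewrite lee_fin sqr_ge0.
rewrite -poweR_EFin EFinM -(dV_box 0); apply: gt0_ler_poweR => //.
- exact/pos/mule_ge0/measure_ge0.
- by apply/pos/integral_ge0 => x _; rewrite lee_fin sqr_ge0.
apply: le_integral_cst => //.
- exact: measurable_box.
- exact: box_Hset.
- by move=> x _; rewrite lee_fin sqr_ge0.
- by move=> x bx; rewrite lee_fin berezin_test_ge.
Qed.
End Test_function.
End Boxes.

(** * Unbounded growth of the ratio of the norms *)

Theorem theorem2 (R : realType) :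
  ~ (exists C : R, forall f : R4 R -> R[i],
        inL2 f -> berezin_defined f ->
        (L2norm (berezin f) <= C%:E * L2norm f)%E).
Proof.
move=> [C HC].
have k0 := kappa_gt0 R.
(* With n = 4 (m+1)^2 the norm sqrt(n/4) is exactly m+1, while that of the transform is at least
   kappa (m+1)^2 / 32; dividing by m+1 gives the bound, which fails for large m. *)
have bound (m : nat) : kappa R * m.+1%:R <= 32 * C.
  have := HC _ (inL2_test R (4 * m.+1 ^ 2)) (berezin_defined_test (4 * m.+1 ^ 2)).
  rewrite L2norm_test -EFinM => /(le_trans (L2norm_berezin_test _ _)).
  rewrite lee_fin.
  have -> : (4 * m.+1 ^ 2)%:R / 4 = m.+1%:R ^+ 2 :> R.
    by rewrite natrM natrX mulrAC divff ?mul1r.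
  rewrite sqrtr_sqr ger0_norm // ler_pdivrMr // expr2 mulrA.
  by rewrite [C * _ * _]mulrAC ler_pM2r ?ltr0Sn // [C * _]mulrC.
have [m Hm] : exists m : nat, 32 * C / kappa R < m.+1%:R.
  by exists (Num.truncn (32 * C / kappa R)); exact: Num.Theory.truncnS_gt.
by have := bound m; rewrite mulrC -ler_pdivlMr // leNgt Hm.
Qed.
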